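(* Let $D$ be a weighted oriented graph consisting of two unbalanced cycles $\mathcal C_m,\mathcal C_n$ (of lengths $m,n$) connected by a path $P$ of length $k\ge1$, labelled as follows: $V(\mathcal C_m)=\{v_1,\dots,v_m\}$, $V(P)=\{v_1,v_{m+1},\dots,v_{m+k}\}$, $V(\mathcal C_n)=\{v_{m+k},v_{m+k+1},\dots,v_{m+k+n-1}\}$, $E(\mathcal C_m)=\{e_1,\dots,e_m\}$, $E(P)=\{e_{m+1},\dots,e_{m+k}\}$, $E(\mathcal C_n)=\{e_{m+k+1},\dots,e_{m+k+n}\}$, where $e_i$ is incident with $v_i,v_{i+1}$ for $1\le i\le m-1$, $e_m$ with $v_m,v_1$, $e_{m+1}$ with $v_1,v_{m+1}$, $e_{m+i}$ with $v_{m+i-1},v_{m+i}$ for $2\le i\le k+n-1$, and $e_{m+k+n}$ with $v_{m+k+n-1},v_{m+k}$. The matrices $A(\mathcal C_m)$, $A(P)$, $A(\mathcal C_n)$ have their rows and columns ordered as the vertices and edges are listed above. Then $I_D$ is generated by the primitive binomial $f_{\mathbf c_m\cup\mathbf p\cup\mathbf c_n}$, where $$\mathbf c_m\cup\mathbf p\cup\mathbf c_n=\frac1d\Big(((-1)^{i+1}p\,r_i)_{i=1}^m,\ ((-1)^ipq\,r_{m+i})_{i=1}^k,\ ((-1)^{i+k}q\,r_{m+k+i})_{i=1}^n\Big)\in\mathbb Z^{m+k+n},$$ with $$\begin{aligned} r_i&=M_k(A(P)[k+1|\emptyset])\,M_{m-1}(A(\mathcal C_m)[1|i]),&&1\le i\le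 m,\\ r_{m+i}&=M_{k-1}(A(P)[1,k+1|i]),&&1\le i\le k,\\ r_{m+k+i}&=M_k(A(P)[1|\emptyset])\,M_{n-1}(A(\mathcal C_n)[1|i]),&&1\le i\le n,\end{aligned}$$ $q=\det A(\mathcal C_m)$, $p=\det A(\mathcal C_n)$, and $d=\gcd\big((|p|r_i)_{i=1}^m,(|pq|r_{m+i})_{i=1}^k,(|q|r_{m+k+i})_{i=1}^n\big)$.
   Context: $K$ is a field. A weighted oriented graph $D=(V(D),E(D),\mathbf w)$ is a finite graph without loops or parallel edges, each edge being given an orientation ($(x,y)$ denotes an edge from $x$ to $y$), together with a weight function $\mathbf w:V(D)\to\{1,2,\dots\}$. Its incidence matrix $A(D)$ has rows indexed by vertices and columns by edges; the entry in row $x$ and column $e$ is $1$ if $e=(x,y)$ for some $y$, $\mathbf w(x)$ if $e=(y,x)$ for some $y$, and $0$ otherwise. The toric ideal $I_D$ is the kernel of the $K$-algebra homomorphism $K[e: e\in E(D)]\to K[x: x\in V(D)]$ sending $e=(x,y)$ to $x\,y^{\mathbf w(y)}$. Cycles and paths in $D$ are those of the underlying undirected graph, with inherited orientations and weights (so each has its own incidence matrix). An (even) cycle $\mathcal C$ is balanced if $\det A(\mathcal C)=0$; a cycle that is not balanced is unbalanced (odd cycles always have nonzero determinant). The cycles $\mathcal C_m,\mathcal C_n$ are connected by $P$ when they are vertex-disjoint and $P$ meets them exactly in its two endpoints, one on each. For a matrix $A$, $M_k(A[i_1,\dots|j_1,\dots])$ denotes the $k\times k$ minor (determinant) obtained from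 $A$ by deleting rows $i_1,\dots$ and columns $j_1,\dots$; $\emptyset$ means no column is deleted, and a $0\times0$ minor equals $1$. For $\mathbf b\in\mathbb Z^N$ (with $N$ the number of edges), $f_{\mathbf b}=\prod_{b_i>0}e_i^{b_i}-\prod_{b_i<0}e_i^{-b_i}$. A nonzero binomial $\mathbf e^{\mathbf u}-\mathbf e^{\mathbf v}\in I_D$ is primitive if there is no other nonzero binomial $\mathbf e^{\mathbf u'}-\mathbf e^{\mathbf v'}\in I_D$ with $\mathbf e^{\mathbf u'}\mid\mathbf e^{\mathbf u}$ and $\mathbf e^{\mathbf v'}\mid\mathbf e^{\mathbf v}$. *)

(* Defs.v *)
From HB Require Import structures.
From mathcomp Require Import all_boot all_order all_algebra.
From mathcomp Require Import mpoly.

Set Implicit Arguments.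
Unset Strict Implicit.
Unset Printing Implicit Defensive.

Import Order.TTheory GRing.Theory Num.Theory.

Local Open Scope ring_scope.

(* [src e] and [tgt e] are x and y when e = (x, y). *)
Record wograph := WOGraph {
  nv : nat;
  ne : nat;
  src : 'I_ne -> 'I_nv;
  tgt : 'I_ne -> 'I_nv;
  wt : 'I_nv -> nat;
  wt_gt0 : forall x, (0 < wt x)%N;
  no_loop : forall e, src e != tgt e;
  no_parallel : forall e e',
    [set src e; tgt e] = [set src e'; tgt e'] -> e = e'
}.

Definition ends (D : wograph) (e : 'I_(ne D)) (x y : 'I_(nv D)) : Prop :=
  [set src e; tgt e] = [set x; y].

Definition incidence (D : wograph) : 'M[int]_(nv D, ne D) :=
  \matrix_(x, e) if x == src e then 1
                 else if x == tgt e then (wt x)%:Z else 0.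

Section Toric.

Variables (K : fieldType) (D : wograph).

Definition toric_map (f : {mpoly K[ne D]}) : {mpoly K[nv D]} :=
  mmap (@mpolyC (nv D) K)
       (fun e : 'I_(ne D) => 'X_(src e) * 'X_(tgt e) ^+ wt (tgt e)) f.

Definition toric_ideal : pred {mpoly K[ne D]} :=
  [pred f | toric_map f == 0].

Definition generates (f : {mpoly K[ne D]}) (I : pred {mpoly K[ne D]}) : Prop :=
  forall g, g \in I <-> exists h, g = h * f.

(* Divisibility of monomials is the componentwise order on exponents. *)
Definition primitive (f : {mpoly K[ne D]}) : Prop :=
  exists u v : 'X_{1..ne D},
    [/\ f = 'X_[u] - 'X_[v], f != 0, f \in toric_ideal &
      forall u' v' : 'X_{1..ne D},
        'X_[u'] - 'X_[v'] != 0 :> {mpoly K[ne D]} ->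
        'X_[u'] - 'X_[v'] \in toric_ideal ->
        (u' <= u)%MM -> (v' <= v)%MM ->
        'X_[u'] - 'X_[v'] = f].

(* Edges are labelled e 1, ..., e N; [b 0 i] is the exponent of e i.+1. *)
Definition binomial_of (N : nat) (e : nat -> 'I_(ne D)) (b : 'rV[int]_N) :
    {mpoly K[ne D]} :=
  \prod_(i < N | 0 < b 0 i) 'X_(e i.+1) ^+ absz (b 0 i)
  - \prod_(i < N | b 0 i < 0) 'X_(e i.+1) ^+ absz (b 0 i).

End Toric.

Arguments toric_ideal : clear implicits.
Arguments binomial_of K {D N} e b.

Definition balanced (l : nat) (A : 'M[int]_l) : bool := \det A == 0.

Definition ord_first (l : nat) (i : 'I_l) : 'I_l :=
  Ordinal (leq_ltn_trans (leq0n i) (ltn_ord i)).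

Section Labelling.

Variables (m k n : nat) (D : wograph).

(* Labels are 1-based: vertices v 1, ..., v (m + k + n - 1) and edges
   e 1, ..., e (m + k + n); other values of v and e are irrelevant. *)
Variables (v : nat -> 'I_(nv D)) (e : nat -> 'I_(ne D)).

Record two_cycles_and_path : Prop := TwoCyclesAndPath {
  vertex_labels : bijective (fun i : 'I_(m + k + n - 1) => v i.+1);
  edge_labels : bijective (fun j : 'I_(m + k + n) => e j.+1);
  ends_Cm : forall i, (1 <= i <= m - 1)%N -> ends (e i) (v i) (v i.+1);
  ends_Cm_last : ends (e m) (v m) (v 1);
  ends_P_first : ends (e (m + 1)) (v 1) (v (m + 1));
  ends_P_Cn : forall i, (2 <= i <= k + n - 1)%N ->
    ends (e (m + i)) (v (m + i - 1)) (v (m + i));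
  ends_Cn_last :
    ends (e (m + k + n)) (v (m + k + n - 1)) (v (m + k))
}.

Definition A_Cm : 'M[int]_m :=
  \matrix_(i < m, j < m) incidence D (v i.+1) (e j.+1).

(* The rows are v 1, v (m + 1), ..., v (m + k). *)
Definition A_P : 'M[int]_(k.+1, k) :=
  \matrix_(i < k.+1, j < k)
    incidence D (v (if i == 0%N :> nat then 1%N else (m + i)%N))
                (e (m + j.+1)).

Definition A_Cn : 'M[int]_n :=
  \matrix_(i < n, j < n) incidence D (v (m + k + i)) (e (m + k + j.+1)).

(* Below an index i of type 'I_l stands for the 1-based index i.+1. *)

Definition r_Cm (i : 'I_m) : int :=
  \det (row' ord_max A_P) * \det (row' (ord_first i) (col' i A_Cm)).

Definition r_P (i : 'I_k) : int :=
  \det (row' (ord_first i) (row' ord_max (col' i A_P))).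

Definition r_Cn (i : 'I_n) : int :=
  \det (row' ord0 A_P) * \det (row' (ord_first i) (col' i A_Cn)).

Let q : int := \det A_Cm.
Let p : int := \det A_Cn.

Definition dgcd : int :=
  (gcdn (gcdn (\big[gcdn/0%N]_(i < m) absz (`|p| * r_Cm i))
              (\big[gcdn/0%N]_(i < k) absz (`|p * q| * r_P i)))
        (\big[gcdn/0%N]_(i < n) absz (`|q| * r_Cn i)))%:Z.

Definition numer : 'rV[int]_(m + k + n) :=
  row_mx (row_mx (\row_(i < m) ((-1) ^+ (i.+1 + 1) * p * r_Cm i))
                 (\row_(i < k) ((-1) ^+ i.+1 * p * q * r_P i)))
         (\row_(i < n) ((-1) ^+ (i.+1 + k) * q * r_Cn i)).

(* Exact division, provided that [dgcd] divides the entries of [numer]. *)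
Definition cpc : 'rV[int]_(m + k + n) :=
  \row_i (numer ord0 i %/ dgcd)%Z.

End Labelling.

(* Main.v *)
Require Import Defs.
From HB Require Import structures.
From mathcomp Require Import all_boot all_order all_algebra.
From mathcomp Require Import mpoly.
From mathcomp Require Import zify ring.

Set Implicit Arguments.
Unset Strict Implicit.
Unset Printing Implicit Defensive.

Import Order.TTheory GRing.Theory Num.Theory.
Local Open Scope ring_scope.

(* The integer kernel of the incidence matrix has rank one: an element x of
   it is determined by t, the entry of A(P) x at v_1, because A(C_m), A(C_n)
   and the path matrix without its last row (triangular) are invertible over
   the rationals, and the equations at each block then read M x = multiple
   of the first unit vector, solved by the first column of the adjugate of
   M. Those columns give the vector of the theorem, so dividing by the gcd
   of its entries yields a generator c of the kernel. Two monomials have the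
   same image exactly when their exponents differ by a multiple of c, and
   X^(tc+) - X^(tc-) is divisible by X^(c+) - X^(c-). *)

(** * Toric ideals of rank one *)

Lemma mpolyX_eq (R : nzRingType) n (a b : 'X_{1..n}) :
  ('X_[a] == 'X_[b] :> {mpoly R[n]}) = (a == b).
Proof.
apply/eqP/eqP => [/(congr1 (mcoeff a))|->//]; rewrite !mcoeffX eqxx.
by case: eqP => [->|_ /eqP] //; rewrite oner_eq0.
Qed.

(** The incidence matrix times [a], computed in the naturals: its entries are nonnegative, so [absz]
    only changes their type. *)
Definition toric_exponent (D : wograph) (a : 'X_{1..ne D}) : 'X_{1..nv D} :=
  [multinom (\sum_e absz (incidence D x e) * a e)%N | x < nv D].

Lemma mmap1_toric (K : fieldType) (D : wograph) (a : 'X_{1..ne D}) :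
  mmap1 (fun e => 'X_(src e) * 'X_(tgt e) ^+ wt (tgt e)) a =
    'X_[toric_exponent a] :> {mpoly K[nv D]}.
Proof.
rewrite /mmap1; under eq_bigr => e _ do rewrite mpolyXn -mpolyXD.
rewrite mprodXnE; congr 'X_[_]; apply/mnmP => x.
rewrite mnm_sumE !mnmE; apply: eq_bigr => e _.
rewrite mulmnE mnmDE mulmnE !mnm1E /incidence !mxE; congr (_ * _)%N.
(* Since [e] is not a loop, its source and target contribute to different rows. *)
rewrite ![x == _]eq_sym; case: (tgt e =P x) => [<-|_]; last by case: eqP.
by rewrite (negbTE (no_loop e)) mul1n.
Qed.

Lemma toric_mapX (K : fieldType) (D : wograph) (a : 'X_{1..ne D}) :
  toric_map (K := K) 'X_[a] = 'X_[toric_exponent a].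
Proof. by rewrite /toric_map mmapX mmap1_toric. Qed.

Lemma incidence_ge0 (D : wograph) x e : 0 <= incidence D x e.
Proof. by rewrite mxE; case: ifP => // _; case: ifP. Qed.

Lemma toric_exponent_eq (D : wograph) (a b : 'X_{1..ne D}) :
  toric_exponent a = toric_exponent b <->
  forall x, \sum_e incidence D x e * ((a e)%:Z - (b e)%:Z) = 0.
Proof.
have E (c : 'X_{1..ne D}) x :
    (toric_exponent c x)%:Z = \sum_e incidence D x e * (c e)%:Z.
  rewrite mnmE (big_morph Posz PoszD erefl); apply: eq_bigr => e _.
  by rewrite PoszM abszE ger0_norm ?incidence_ge0.
split=> [/mnmP ab x|ab].
  by under eq_bigr do rewrite mulrBr; rewrite sumrB -!E ab subrr.
apply/mnmP => x; move: (ab x).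
by under eq_bigr do rewrite mulrBr; rewrite sumrB -!E; lia.
Qed.

Lemma binomial_in_toric_ideal (K : fieldType) (D : wograph)
    (a b : 'X_{1..ne D}) :
  'X_[a] - 'X_[b] \in toric_ideal K D <-> toric_exponent a = toric_exponent b.
Proof.
rewrite inE.
have -> : toric_map (K := K) ('X_[a] - 'X_[b]) =
    'X_[toric_exponent a] - 'X_[toric_exponent b].
  by rewrite -!toric_mapX; exact: raddfB.
by rewrite subr_eq0 mpolyX_eq; split=> /eqP.
Qed.

(* Replacing each monomial of [g] by a representative of its fibre under
   [toric_exponent] gives 0, because the coefficients of [g] sum to 0 over each
   fibre. *)
Lemma toric_ideal_sum (K : fieldType) (D : wograph) (g : {mpoly K[ne D]}) :
  g \in toric_ideal K D ->
  exists rep : 'X_{1..ne D} -> 'X_{1..ne D},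
    (forall a, toric_exponent (rep a) = toric_exponent a) /\
    g = \sum_(a <- msupp g) g@_a *: ('X_[a] - 'X_[rep a]).
Proof.
move=> gI; pose fib (a : 'X_{1..ne D}) :=
  [pred b : 'X_{1..ne D} | toric_exponent b == toric_exponent a].
(* Started at a point of the fibre, [choose] depends on the fibre only, so [rep] is a canonical
   representative. *)
pose rep a := choose (fib a) a.
have repE a : toric_exponent (rep a) = toric_exponent a.
  by apply/eqP/(@chooseP _ (fib a)); rewrite /= eqxx.
have rep_eq a b : toric_exponent a = toric_exponent b -> rep a = rep b.
  move=> Eab; rewrite /rep (@eq_choose _ (fib a) (fib b)).
    by apply: choose_id; rewrite /= ?Eab eqxx.
  by move=> c; rewrite /= Eab.
exists rep; split=> //.
under eq_bigr do rewrite scalerBr.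
rewrite big_split /= -mpolyE sumrN.
suff -> : \sum_(a <- msupp g) g@_a *: 'X_[K, rep a] = 0 by rewrite subr0.
apply/mpolyP => c; rewrite mcoeff0 raddf_sum /=.
under eq_bigr do rewrite mcoeffZ mcoeffX.
have [rc|nrc] := eqVneq (rep c) c; last first.
  rewrite big1 // => a _; case: eqP => [rac|_]; last by rewrite mulr0.
  by move: nrc; rewrite -{1}rac (rep_eq (rep a) a) // rac eqxx.
(* As [c] represents its own fibre, the sum collects the coefficients over that fibre, which is the
   coefficient of the image of [g] at [toric_exponent c]. *)
move: gI; rewrite inE => /eqP/(congr1 (mcoeff (toric_exponent c))).
rewrite /toric_map /mmap mcoeff0 raddf_sum /= => g0; rewrite -[RHS]g0.
apply: eq_bigr => a _; rewrite mcoeffCM mmap1_toric mcoeffX.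
congr (_ * _%:R); congr nat_of_bool.
apply/eqP/eqP => [<-|/rep_eq ->] //; by rewrite repE.
Qed.

Section RankOne.

Variables (K : fieldType) (D : wograph) (c : 'I_(ne D) -> int).

Definition pos_exponent : 'X_{1..ne D} :=
  [multinom if (0 < c e)%R then absz (c e) else 0%N | e < ne D].
Definition neg_exponent : 'X_{1..ne D} :=
  [multinom if (c e < 0)%R then absz (c e) else 0%N | e < ne D].

Hypothesis c_neq0 : exists e, c e != 0.
Hypothesis fibreE : forall a b : 'X_{1..ne D},
  toric_exponent a = toric_exponent b <->
  exists t : int, forall e, (a e)%:Z - (b e)%:Z = t * c e.

Let f : {mpoly K[ne D]} := 'X_[pos_exponent] - 'X_[neg_exponent].

Lemma exponentsP e :
  c e = (pos_exponent e)%:Z - (neg_exponent e)%:Z /\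
  (pos_exponent e = 0%N \/ neg_exponent e = 0%N).
Proof. by rewrite !mnmE; case: (ltgtP (c e) 0); lia. Qed.

Lemma rank_one_in_toric_ideal : f \in toric_ideal K D.
Proof.
apply/binomial_in_toric_ideal/fibreE; exists 1 => e.
by rewrite mul1r; case: (exponentsP e).
Qed.

Lemma rank_one_primitive : primitive f.
Proof.
have [e0 ce0] := c_neq0.
exists pos_exponent, neg_exponent; split => //.
- rewrite subr_eq0 mpolyX_eq; apply/eqP => /mnmP/(_ e0).
  by case: (exponentsP e0); lia.
- exact: rank_one_in_toric_ideal.
move=> a b; rewrite subr_eq0 mpolyX_eq => neq_ab.
move=> /binomial_in_toric_ideal/fibreE[t tE] /mnm_lepP lea /mnm_lepP leb.
(* One of the two exponents vanishes at [e0], so the divisibility bounds place [t * c e0] between 0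
   and [c e0]. *)
have t01 : t = 0 \/ t = 1.
  move: (tE e0) (lea e0) (leb e0) ce0; case: (exponentsP e0) => ->.
  by case=> ->; nia.
case: t01 => t_eq; move: tE; rewrite {}t_eq => tE.
  by case/eqP: neq_ab; apply/mnmP => e; move: (tE e); lia.
by congr ('X_[_] - 'X_[_]); apply/mnmP => e;
  move: (tE e) (lea e) (leb e); case: (exponentsP e) => ->; lia.
Qed.

(** The two exponents have disjoint supports, so a common monomial splits off and leaves y^t - z^t,
    a multiple of y - z. *)
Lemma rank_one_dvd (a b : 'X_{1..ne D}) (t : nat) :
  (forall e, (a e)%:Z - (b e)%:Z = t%:Z * c e) ->
  exists h, 'X_[a] - 'X_[b] = h * f.
Proof.
(* The truncated difference is exact: where [c] is positive, [a] is at least [t * c]; elsewhere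
   [pos_exponent] is 0. *)
move=> tE; pose w := (a - pos_exponent *+ t)%MM.
have split_ab e : [/\ a e = (w e + pos_exponent e * t)%N
                    & b e = (w e + neg_exponent e * t)%N].
  rewrite mnmBE mulmnE; move: (tE e); case: (exponentsP e) => -> [] ->; nia.
have -> : a = (w + pos_exponent *+ t)%MM.
  by apply/mnmP => e; rewrite mnmDE mulmnE; case: (split_ab e).
have -> : b = (w + neg_exponent *+ t)%MM.
  by apply/mnmP => e; rewrite mnmDE mulmnE; case: (split_ab e).
rewrite !mpolyXD -!mpolyXn -mulrBr subrXX mulrCA mulrC.
by eexists.
Qed.

Lemma rank_one_generates : generates f (toric_ideal K D).
Proof.
move=> g; split; last first.
  case=> h ->; rewrite inE /toric_map rmorphM /= -/(toric_map f).
  by move: rank_one_in_toric_ideal; rewrite inE => /eqP ->; rewrite mulr0.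
case/toric_ideal_sum => rep [repE ->].
elim/big_ind: _ => [|x y [h ->] [h' ->]|a _].
- by exists 0; rewrite mul0r.
- by exists (h + h'); rewrite mulrDl.
have /fibreE[[t|t] tE] := esym (repE a).
  have [h ->] := rank_one_dvd tE.
  by exists (g@_a *: h); rewrite scalerAl.
(* Here the multiple is -(t + 1); exchanging the two monomials makes it positive. *)
have [|h hE] := @rank_one_dvd (rep a) a t.+1.
  by move=> e; move: (tE e); rewrite NegzE; lia.
by exists (- g@_a *: h); rewrite -scalerAl -hE scaleNr -scalerN opprB.
Qed.

End RankOne.

(** * The kernel equations *)

Section BlockSystem.

Variables (R : comNzRingType) (m k n : nat).
Variables (A : 'M[R]_m.+1) (P : 'M[R]_(k.+2, k.+1)) (C : 'M[R]_n.+1).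

Let Ptop : 'M[R]_k.+1 := row' ord_max P.
Let Pbot : 'M[R]_k.+1 := row' ord0 P.

(** The kernel equations grouped by vertices, for the parts of a vector on C_m, P and C_n. The path
    interacts with the cycles only at its two ends, which are the first vertices of both cycles. *)
Definition block_system (x : 'cV[R]_m.+1) (y : 'cV[R]_k.+1)
    (z : 'cV[R]_n.+1) : Prop :=
  [/\ A *m x = - (P *m y) ord0 0 *: delta_mx ord0 0,
      forall i, i != ord0 -> i != ord_max -> (P *m y) i 0 = 0
    & C *m z = - (P *m y) ord_max 0 *: delta_mx ord0 0].

Lemma mulmx_adj_col0 l (M : 'M[R]_l.+1) :
  M *m col ord0 (\adj M) = \det M *: delta_mx ord0 0.
Proof. by rewrite colE mulmxA mul_mx_adj mul_scalar_mx. Qed.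

(** Cramer's rule without division: multiply on the left by the adjugate. *)
Lemma det_scale_solution l (M : 'M[R]_l.+1) (x : 'cV_l.+1) (t : R) :
  M *m x = t *: delta_mx ord0 0 -> \det M *: x = t *: col ord0 (\adj M).
Proof.
move=> Mx; rewrite -mul_scalar_mx -mul_adj_mx -mulmxA Mx -scalemxAr.
by rewrite -colE.
Qed.

Lemma row_lift_max (i : 'I_k.+1) (y : 'cV_k.+1) :
  (P *m y) (lift ord_max i) 0 = (Ptop *m y) i 0 :> R.
Proof. by rewrite !mxE; apply: eq_bigr => j _; rewrite !mxE. Qed.

Lemma lift_max0 : lift ord_max ord0 = ord0 :> 'I_k.+2.
Proof. exact: val_inj. Qed.

(* The minors of [P] without its first and last rows are cofactors both of
   [Ptop] along its first row and of [Pbot] along its last row. *)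
Lemma last_row_adj :
  (P *m col ord0 (\adj Ptop)) ord_max 0 = (-1) ^+ k * \det Pbot.
Proof.
rewrite (expand_det_row _ ord_max) mulr_sumr mxE; apply: eq_bigr => j _.
rewrite !mxE /cofactor.
have -> : lift ord0 ord_max = ord_max :> 'I_k.+2 by exact: val_inj.
have -> : row' ord_max (col' j Pbot) = row' ord0 (col' j Ptop).
  apply/matrixP => a b; rewrite !mxE; congr (P _ _).
  by apply: val_inj; rewrite /= /bump /=; have := ltn_ord a; lia.
(* Expansion along the last row has sign (-1)^(k+j); times the outer (-1)^k this is (-1)^j, the sign
   along the first row. *)
rewrite [RHS]mulrCA; congr (_ * _); rewrite mulrA -exprD addnA addnn.
rewrite -[RHS]/((-1) ^+ (k.*2 + j) * _) -[in RHS]signr_odd.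
by rewrite oddD odd_double signr_odd.
Qed.

(** The three blocks of the numerators of the theorem: counting from 0, entry i of the first
    adjugate column is (-1)^i times the minor without the first row and column i. *)
Definition sol_Cm := (\det C * \det Ptop) *: col ord0 (\adj A).
Definition sol_P := - (\det C * \det A) *: col ord0 (\adj Ptop).
Definition sol_Cn := ((-1) ^+ k * \det A * \det Pbot) *: col ord0 (\adj C).

Lemma block_system_sol : block_system sol_Cm sol_P sol_Cn.
Proof.
have top : (P *m sol_P) ord0 0 = - (\det C * \det A) * \det Ptop.
  rewrite -lift_max0 row_lift_max /sol_P -scalemxAr mulmx_adj_col0.
  by rewrite !mxE !eqxx mulr1.
have bot : (P *m sol_P) ord_max 0 =
    - (\det C * \det A) * ((-1) ^+ k * \det Pbot).
  by rewrite -last_row_adj /sol_P -scalemxAr [LHS]mxE.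
split.
- rewrite top /sol_Cm -scalemxAr mulmx_adj_col0 scalerA; congr (_ *: _); ring.
- move=> i i0 imax; have [j ji] : {j | i = lift ord_max j}.
    by case: (unliftP ord_max i) imax => [j ->|->]; [exists j | rewrite eqxx].
  rewrite ji row_lift_max /sol_P -scalemxAr mulmx_adj_col0 !mxE.
  case: eqP => [j0|_]; last by rewrite !mulr0.
  by rewrite ji j0 lift_max0 eqxx in i0.
- rewrite bot /sol_Cn -scalemxAr mulmx_adj_col0 scalerA; congr (_ *: _); ring.
Qed.

Lemma block_system_unique x y z : block_system x y z ->
  exists t, let s := \det C * \det A * \det Ptop in
    [/\ s *: x = t *: sol_Cm, s *: y = t *: sol_P & s *: z = t *: sol_Cn].
Proof.
case=> Ax Pmid Cz; set t := (P *m y) ord0 0 in Ax.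
have Py : Ptop *m y = t *: delta_mx ord0 0.
  apply/matrixP => i j; rewrite (ord1 j) -row_lift_max.
  have [->|i0] := eqVneq i ord0.
    by rewrite lift_max0 -/t !mxE !eqxx mulr1.
  rewrite Pmid ?neq_lift ?[_ == ord_max]eq_sym ?neq_lift //.
    by rewrite !mxE (negbTE i0) mulr0.
  apply: contra i0 => /eqP; rewrite -lift_max0 => /lift_inj ->.
  by rewrite eqxx.
have Dy := det_scale_solution Py.
have Dx := det_scale_solution Ax.
have Dz := det_scale_solution Cz.
(* [y] is known only after scaling by [\det Ptop], so its value at the far end of the path is
   computed with that factor. *)
have Pmax : \det Ptop * (P *m y) ord_max 0 = t * ((-1) ^+ k * \det Pbot).
  have := congr1 (fun u => (P *m u) ord_max 0) Dy.
  by rewrite -!scalemxAr !mxE -last_row_adj !mxE.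
(* The sign of the multiplier compensates the minus sign in [sol_P]. *)
exists (- t) => s; split.
- rewrite /s /sol_Cm -mulrA mulrCA mulrC -!scalerA Dx !scalerA.
  by congr (_ *: _); ring.
- by rewrite /s /sol_P -scalerA Dy !scalerA; congr (_ *: _); ring.
have -> : s = \det A * \det Ptop * \det C by rewrite /s; ring.
rewrite -scalerA Dz /sol_Cn !scalerA; congr (_ *: _).
by rewrite mulrN -mulrA Pmax; ring.
Qed.

End BlockSystem.

(** * Incidences of the labelled graph *)

Lemma incidence_eq0 (D : wograph) (e : 'I_(ne D)) (x y z : 'I_(nv D)) :
  ends e x y -> (incidence D z e == 0) = (z != x) && (z != y).
Proof.
move=> /setP/(_ z); rewrite !inE mxE -negb_or => <-.
case: (z == src e) => //=; case: (z == tgt e) => //=.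
(* The entry at the target is a positive weight. *)
by have := wt_gt0 z; lia.
Qed.

Lemma scale_delta_col0 (R : pzRingType) l (t : R) (i : 'I_l.+1) :
  (- t *: delta_mx ord0 0 : 'cV_l.+1) i 0 = - ((i == ord0)%:R * t).
Proof. by rewrite !mxE andbT mulNr mulr_natl mulr_natr. Qed.

Section Labels.

Variables (m k n : nat) (D : wograph).
Variables (v : nat -> 'I_(nv D)) (e : nat -> 'I_(ne D)).
Hypothesis hD : two_cycles_and_path m.+1 k.+1 n.+1 v e.
Hypothesis n_gt0 : (0 < n)%N.

(** Labels of the endpoints of e_j: j and j+1 on C_m, j-1 and j from there on, except for the
    closing edges of both cycles and the first edge of the path. *)
Definition end1 j :=
  if (j <= m.+1)%N then j else if j == m.+2 then 1%N else j.-1.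
Definition end2 j :=
  if (j <= m)%N then j.+1 else if j == m.+1 then 1%N else
  if j == (m.+1 + k.+1 + n.+1)%N then (m.+1 + k.+1)%N else j.

Lemma ends_label j : (1 <= j <= m.+1 + k.+1 + n.+1)%N ->
  ends (e j) (v (end1 j)) (v (end2 j)).
Proof.
move=> jN; rewrite /end1 /end2.
have [jm|jm] := leqP j m.
  by rewrite ifT; [apply: (ends_Cm hD); lia | lia].
have [->|jm1] := eqVneq j m.+1.
  by rewrite leqnn; apply: (ends_Cm_last hD).
rewrite ifF; last lia.
have [->|jm2] := eqVneq j m.+2.
  by rewrite ifF; [have := ends_P_first hD; rewrite addn1 | lia].
have [->|jl] := eqVneq j (m.+1 + k.+1 + n.+1)%N.
  by have := ends_Cn_last hD; rewrite subn1.
have /= := ends_P_Cn hD (i := j - m.+1).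
have -> : (m.+1 + (j - m.+1) = j)%N by lia.
by rewrite !subn1; apply; lia.
Qed.

Lemma v_inj i j : (1 <= i <= m.+1 + k.+1 + n)%N ->
  (1 <= j <= m.+1 + k.+1 + n)%N -> (v i == v j) = (i == j).
Proof.
move=> iV jV; apply/eqP/eqP => [vij|->//].
have lt_pred l : (1 <= l <= m.+1 + k.+1 + n)%N ->
  (l.-1 < m.+1 + k.+1 + n.+1 - 1)%N by lia.
have := bij_inj (vertex_labels hD) (x1 := Ordinal (lt_pred i iV))
  (x2 := Ordinal (lt_pred j jV)).
rewrite /= !prednK; try lia.
by move=> /(_ vij) [] /=; lia.
Qed.

Lemma incidence_label i j : (1 <= i <= m.+1 + k.+1 + n)%N ->
  (1 <= j <= m.+1 + k.+1 + n.+1)%N ->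
  (incidence D (v i) (e j) == 0) = (i != end1 j) && (i != end2 j).
Proof.
move=> iV jN; rewrite (incidence_eq0 _ (ends_label jN)) !v_inj //.
  by rewrite /end2; do ?case: ifP => ?; lia.
by rewrite /end1; do ?case: ifP => ?; lia.
Qed.

Local Notation ACm := (A_Cm m.+1 v e).
Local Notation AP := (A_P m.+1 k.+1 v e).
Local Notation ACn := (A_Cn m.+1 k.+1 n.+1 v e).

Lemma A_CmE i j : ACm i j = incidence D (v i.+1) (e j.+1).
Proof. by rewrite mxE. Qed.

Lemma A_PE i j : AP i j =
  incidence D (v (if i == 0%N :> nat then 1%N else (m.+1 + i)%N))
    (e (m.+1 + j.+1)).
Proof. by rewrite mxE. Qed.

Lemma A_CnE i j : ACn i j =
  incidence D (v (m.+1 + k.+1 + i)) (e (m.+1 + k.+1 + j.+1)).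
Proof. by rewrite mxE. Qed.

Lemma incidence_label0 i j : (1 <= i <= m.+1 + k.+1 + n)%N ->
  (1 <= j <= m.+1 + k.+1 + n.+1)%N -> i != end1 j -> i != end2 j ->
  incidence D (v i) (e j) = 0.
Proof. by move=> iV jN i1 i2; apply/eqP; rewrite incidence_label ?i1. Qed.

(** Each path edge joins consecutive path vertices, so this matrix is lower triangular; its diagonal
    holds each edge's entry at its earlier endpoint, which is 1 or a weight. *)
Lemma det_path_top_neq0 : \det (row' ord_max AP : 'M_k.+1) != 0.
Proof.
rewrite det_trig; last first.
  apply/is_trig_mxP => i j ij; rewrite 2!mxE /= /bump /=.
  have := ltn_ord i; have := ltn_ord j => jk ik.
  by apply: incidence_label0; rewrite /end1 /end2; do ?case: ifP; lia.
apply/prodf_neq0 => i _; rewrite 2!mxE /= /bump /=; have := ltn_ord i => ik.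
by rewrite incidence_label /end1 /end2; do ?case: ifP; lia.
Qed.

Let N := (m.+1 + k.+1 + n.+1)%N.

Section Kernel.

Variable b : 'rV[int]_N.
Let x := (lsubmx (lsubmx b))^T.
Let y := (rsubmx (lsubmx b))^T.
Let z := (rsubmx b)^T.
Let S w := \sum_(j < N) incidence D w (e j.+1) * b 0 j.

Lemma edge_sum_split w : S w =
  \sum_(j < m.+1) incidence D w (e j.+1) * x j 0 +
  \sum_(j < k.+1) incidence D w (e (m.+1 + j.+1)) * y j 0 +
  \sum_(j < n.+1) incidence D w (e (m.+1 + k.+1 + j.+1)) * z j 0.
Proof.
rewrite /S big_split_ord big_split_ord; congr (_ + _ + _);
  apply: eq_bigr => j _; congr (incidence D w (e _) * _);
  by rewrite ?mxE /= ?addnS.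
Qed.

(** Among the vertices of C_m only v_1 lies on the path, hence the extra term in the first row. *)
Lemma edge_sum_Cm (i : 'I_m.+1) :
  S (v i.+1) = (ACm *m x) i 0 + (i == ord0)%:R * (AP *m y) ord0 0.
Proof.
have im := ltn_ord i.
rewrite edge_sum_split [X in _ + X]big1 ?addr0 => [|j _]; last first.
  have := ltn_ord j => jn.
  by rewrite incidence_label0 ?mul0r /end1 /end2; do ?case: ifP; lia.
congr (_ + _); first by rewrite [RHS]mxE; apply: eq_bigr => j _; rewrite A_CmE.
have [->|i0] := eqVneq i ord0; rewrite ?mul1r ?mul0r.
  by rewrite [RHS]mxE; apply: eq_bigr => j _; rewrite A_PE.
rewrite big1 // => j _; have := ltn_ord j => jk; rewrite -val_eqE /= in i0.
by rewrite incidence_label0 ?mul0r /end1 /end2; do ?case: ifP; lia.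
Qed.

Lemma edge_sum_P (i : 'I_k.+2) : i != ord0 -> i != ord_max ->
  S (v (m.+1 + i)) = (AP *m y) i 0.
Proof.
have ik := ltn_ord i; rewrite -!val_eqE /= => i0 imax.
rewrite edge_sum_split [X in _ + X]big1 ?addr0 => [|j _]; last first.
  have := ltn_ord j => jn.
  by rewrite incidence_label0 ?mul0r /end1 /end2; do ?case: ifP; lia.
rewrite [X in X + _]big1 ?add0r => [|j _]; last first.
  have := ltn_ord j => jn.
  by rewrite incidence_label0 ?mul0r /end1 /end2; do ?case: ifP; lia.
by rewrite [RHS]mxE; apply: eq_bigr => j _; rewrite A_PE (negbTE i0).
Qed.

(** The first row of A(C_n) and the last row of A(P) belong to the same vertex. *)
Lemma edge_sum_Cn (i : 'I_n.+1) :
  S (v (m.+1 + k.+1 + i)) =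
    (ACn *m z) i 0 + (i == ord0)%:R * (AP *m y) ord_max 0.
Proof.
have il := ltn_ord i; rewrite edge_sum_split addrC.
congr (_ + _); first by rewrite [RHS]mxE; apply: eq_bigr => j _; rewrite A_CnE.
rewrite [X in X + _]big1 ?add0r => [|j _]; last first.
  have := ltn_ord j => jn.
  by rewrite incidence_label0 ?mul0r /end1 /end2; do ?case: ifP; lia.
have [->|i0] := eqVneq i ord0; rewrite ?mul1r ?mul0r.
  by rewrite [RHS]mxE; apply: eq_bigr => j _; rewrite A_PE addn0.
rewrite big1 // => j _; have := ltn_ord j => jk; rewrite -val_eqE /= in i0.
by rewrite incidence_label0 ?mul0r /end1 /end2; do ?case: ifP; lia.
Qed.

Lemma edge_kernelP :
  (forall w, S w = 0) <-> block_system ACm AP ACn x y z.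
Proof.
split=> [S0|[eqA eqP eqC] w].
  split=> [|i i0 imax|].
  - apply/matrixP => i j; rewrite (ord1 j); have := S0 (v i.+1).
    by rewrite edge_sum_Cm scale_delta_col0 => /eqP; rewrite addr_eq0 => /eqP.
  - by rewrite -edge_sum_P.
  - apply/matrixP => i j; rewrite (ord1 j); have := S0 (v (m.+1 + k.+1 + i)).
    by rewrite edge_sum_Cn scale_delta_col0 => /eqP; rewrite addr_eq0 => /eqP.
have [g gK vK] := vertex_labels hD.
rewrite -(vK w); have := ltn_ord (g w); move: (nat_of_ord (g w)) => i iV.
(* The vertex is v_(i+1). The ends of the path are treated with their cycles, so the middle range
   consists of interior path vertices. *)
have [im|im] := ltnP i m.+1.
  by rewrite (edge_sum_Cm (Ordinal im)) eqA scale_delta_col0 addNr.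
have [ik|ik] := ltnP i.+1 (m.+1 + k.+1).
  have ik' : (i.+1 - m.+1 < k.+2)%N by lia.
  have -> : i.+1 = (m.+1 + Ordinal ik')%N by rewrite /=; lia.
  rewrite edge_sum_P ?eqP // -val_eqE /=; lia.
have il : (i.+1 - (m.+1 + k.+1) < n.+1)%N by lia.
have -> : i.+1 = (m.+1 + k.+1 + Ordinal il)%N by rewrite /=; lia.
by rewrite edge_sum_Cn eqC scale_delta_col0 addNr.
Qed.

End Kernel.

End Labels.

(** * The vector of the theorem generates the kernel *)

(** Since [s] divides every [t * c i], it divides [t * d]; the quotient is the required multiple. *)
Lemma proportional_primitive l (c b : 'I_l -> int) (d : nat) (s t : int) :
  d = \big[gcdn/0%N]_i `|c i|%N -> d != 0%N -> s != 0 ->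
  (forall i, s * b i = t * c i) ->
  exists t', forall i, b i = t' * (c i %/ d%:Z)%Z.
Proof.
move=> dE d0 s0 sb.
have dvdc i : (d%:Z %| c i)%Z by rewrite dvdzE dE; apply: (biggcdn_inf i).
have /dvdzP[t' tE] : (s %| t * d%:Z)%Z.
  rewrite dvdzE abszM /= dE (big_morph (muln `|t|%N) (muln_gcdr _) (muln0 _)).
  by apply/dvdn_biggcdP => i _; rewrite -abszM -sb abszM dvdn_mulr.
exists t' => i; apply: (mulfI s0).
by rewrite sb mulrA [s * t']mulrC -tE -mulrA [d%:Z * _]mulrC divzK.
Qed.

Section Numerators.

Variables (m k n : nat) (D : wograph).
Variables (v : nat -> 'I_(nv D)) (e : nat -> 'I_(ne D)).

Local Notation ACm := (A_Cm m.+1 v e).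
Local Notation AP := (A_P m.+1 k.+1 v e).
Local Notation ACn := (A_Cn m.+1 k.+1 n.+1 v e).
Local Notation c := (numer m.+1 k.+1 n.+1 v e).

Lemma numer_Cm : (lsubmx (lsubmx c))^T = sol_Cm ACm AP ACn.
Proof.
rewrite /numer !row_mxKl; apply/matrixP => i j.
rewrite !mxE /r_Cm /cofactor (_ : ord_first i = ord0); last exact: val_inj.
by rewrite addn1 !exprS /=; ring.
Qed.

Lemma numer_P : (rsubmx (lsubmx c))^T = sol_P ACm AP ACn.
Proof.
rewrite /numer row_mxKl row_mxKr; apply/matrixP => i j.
rewrite !mxE /r_P /cofactor.
(* Deleting the last row commutes with deleting a column. *)
have -> : row' (ord_first i) (row' ord_max (col' i AP)) =
    row' ord0 (col' i (row' ord_max AP : 'M_k.+1)).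
  apply/matrixP => a b; move: AP => M; rewrite !mxE.
  by rewrite (_ : ord_first i = ord0) //; apply: val_inj.
by rewrite !exprS /=; ring.
Qed.

Lemma numer_Cn : (rsubmx c)^T = sol_Cn ACm AP ACn.
Proof.
rewrite /numer row_mxKr; apply/matrixP => i j.
rewrite !mxE /r_Cn /cofactor (_ : ord_first i = ord0); last exact: val_inj.
(* The path has length [k.+1], so the exponent is i + k + 2, of the same parity as i + k. *)
by rewrite addSn addnS !exprS exprD /=; ring.
Qed.

Lemma dgcdE : dgcd m.+1 k.+1 n.+1 v e = (\big[gcdn/0%N]_i `|c ord0 i|%N)%:Z.
Proof.
rewrite /dgcd !big_split_ord; congr (gcdn (gcdn _ _) _)%:Z;
  apply: eq_bigr => i _;
  by rewrite ?row_mxEl ?row_mxEr mxE !abszM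
    !absz_id ?abszM ?abszX ?exp1n ?mul1n.
Qed.

End Numerators.

Section Kernel.

Variables (m k n : nat) (D : wograph).
Variables (v : nat -> 'I_(nv D)) (e : nat -> 'I_(ne D)).
Hypothesis hD : two_cycles_and_path m.+1 k.+1 n.+1 v e.
Hypothesis n_gt0 : (0 < n)%N.

Local Notation ACm := (A_Cm m.+1 v e).
Local Notation AP := (A_P m.+1 k.+1 v e).
Local Notation ACn := (A_Cn m.+1 k.+1 n.+1 v e).
Local Notation c := (numer m.+1 k.+1 n.+1 v e).
Local Notation d := (dgcd m.+1 k.+1 n.+1 v e).
Local Notation N := (m.+1 + k.+1 + n.+1)%N.

Hypothesis hCm : ~~ balanced ACm.
Hypothesis hCn : ~~ balanced ACn.

Let dets : int := \det ACn * \det ACm * \det (row' ord_max AP : 'M_k.+1).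

Lemma dets_neq0 : dets != 0.
Proof. by rewrite !mulf_neq0 // (det_path_top_neq0 hD). Qed.

Lemma numer_kernel w : \sum_(j < N) incidence D w (e j.+1) * c 0 j = 0.
Proof.
move: w; apply/(edge_kernelP hD n_gt0); rewrite numer_Cm numer_P numer_Cn.
exact: block_system_sol.
Qed.

(** Applying the truncated path matrix to the path block gives first entry [- dets], so this block
    is nonzero. *)
Lemma numer_neq0 : c != 0.
Proof.
have : sol_P ACm AP ACn != 0.
  apply: contra dets_neq0 => /eqP sol0; rewrite /dets.
  have := mulmx_adj_col0 (row' ord_max AP : 'M_k.+1).
  move=> /(congr1 (fun u => - (\det ACn * \det ACm) *: u)).
  rewrite scalemxAr -/(sol_P ACm AP ACn) sol0 mulmx0 scalerA.
  move=> /matrixP/(_ ord0 0).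
  by rewrite !mxE !eqxx mulr1 mulNr => /esym/eqP; rewrite oppr_eq0.
by apply: contra => /eqP c0; rewrite -numer_P c0 !linear0.
Qed.

Lemma dgcd_neq0 : d != 0.
Proof.
apply: contra numer_neq0; rewrite dgcdE => /eqP[d0].
apply/eqP/rowP => i; rewrite [RHS]mxE.
have : ((\big[gcdn/0]_i `|c ord0 i|) %| `|c ord0 i|)%N.
  exact: (biggcdn_inf i).
by rewrite d0 dvd0n absz_eq0 => /eqP.
Qed.

Lemma dgcd_dvd i : (d %| c ord0 i)%Z.
Proof. by rewrite dvdzE dgcdE; apply: (biggcdn_inf i). Qed.

Lemma kernel_rank_one (b : 'rV[int]_N) :
  (forall w, \sum_(j < N) incidence D w (e j.+1) * b 0 j = 0) <->
  exists t, forall j, b 0 j = t * cpc m.+1 k.+1 n.+1 v e 0 j.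
Proof.
split=> [/(edge_kernelP hD n_gt0)/block_system_unique[t]|[t bE] w].
  rewrite -numer_Cm -numer_P -numer_Cn -/dets => -[tx ty tz].
  have sb : dets *: b = t *: c.
    rewrite -[b]hsubmxK -[lsubmx b]hsubmxK -[c]hsubmxK -[lsubmx c]hsubmxK.
    rewrite !scale_row_mx; congr (row_mx (row_mx _ _) _);
    by apply: trmx_inj; rewrite !linearZ.
  have [||||t' tE] := @proportional_primitive N (c ord0) (b 0) `|d| dets t.
  - by rewrite dgcdE.
  - by rewrite absz_eq0 dgcd_neq0.
  - exact: dets_neq0.
  - move=> i; have := congr1 (fun u : 'rV[int]_N => u ord0 i) sb.
    by rewrite [LHS]mxE [RHS]mxE.
  by exists t' => j; rewrite tE [cpc _ _ _ _ _ _ _]mxE dgcdE.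
(* Multiplying by the gcd undoes the exact division in [cpc] and reduces the claim to
   [numer_kernel]. *)
apply: (mulfI dgcd_neq0); rewrite mulr0 mulr_sumr.
rewrite -[RHS](mulr0 t) -[X in _ = t * X](numer_kernel w) mulr_sumr.
apply: eq_bigr => j _.
by rewrite bE [cpc _ _ _ _ _ _ _]mxE -[in RHS](divzK (dgcd_dvd j)); ring.
Qed.

End Kernel.

(** * The toric ideal of two cycles joined by a path *)

Lemma binomial_ofE (K : fieldType) (D : wograph) N (e : nat -> 'I_(ne D))
    (b : 'rV[int]_N) (c : 'I_(ne D) -> int) :
  bijective (fun j : 'I_N => e j.+1) -> (forall j : 'I_N, c (e j.+1) = b 0 j) ->
  binomial_of K e b = 'X_[pos_exponent c] - 'X_[neg_exponent c].
Proof.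
move=> bij_e cE; rewrite /binomial_of !mpolyXE_id.
congr (_ - _); rewrite big_mkcond [RHS](reindex _ (onW_bij _ bij_e)) /=;
  by apply: eq_bigr => j _; rewrite mnmE cE; case: ifP.
Qed.

Theorem theorem4p10 (K : fieldType) (m k n : nat) (D : wograph)
    (v : nat -> 'I_(nv D)) (e : nat -> 'I_(ne D))
    (hm : (3 <= m)%N) (hn : (3 <= n)%N) (hk : (1 <= k)%N)
    (hD : two_cycles_and_path m k n v e)
    (hCm : ~~ balanced (A_Cm m v e))
    (hCn : ~~ balanced (A_Cn m k n v e)) :
  [/\ forall i : 'I_(m + k + n),
        (dgcd m k n v e %| numer m k n v e ord0 i)%Z,
      primitive (binomial_of K e (cpc m k n v e)) &
      generates (binomial_of K e (cpc m k n v e)) (toric_ideal K D)].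
Proof.
case: m k n hm hn hk hD hCm hCn => [|m] [|k] [|n] // _ hn _ hD hCm hCn.
have n_gt0 : (0 < n)%N by lia.
set b := cpc _ _ _ _ _; have [g gK eK] := edge_labels hD.
(* The exponents are carried from labels to edges by the inverse labelling [g]. *)
pose c x := b 0 (g x).
have cE (j : 'I_(m.+1 + k.+1 + n.+1)) : c (e j.+1) = b 0 j.
  by rewrite /c; congr (b 0 _); apply: gK.
rewrite (binomial_ofE K (edge_labels hD) cE).
have fibreE (a a' : 'X_{1..ne D}) : toric_exponent a = toric_exponent a' <->
    exists t : int, forall x, (a x)%:Z - (a' x)%:Z = t * c x.
  rewrite toric_exponent_eq.
  pose u : 'rV[int]_(m.+1 + k.+1 + n.+1) :=
    \row_j ((a (e j.+1))%:Z - (a' (e j.+1))%:Z).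
  have uE w : \sum_x incidence D w x * ((a x)%:Z - (a' x)%:Z) =
      \sum_(j < m.+1 + k.+1 + n.+1) incidence D w (e j.+1) * u 0 j.
    rewrite (reindex _ (onW_bij _ (edge_labels hD))) /=.
    by apply: eq_bigr => j _; rewrite [u _ _]mxE.
  split=> [ker|[t tE] w].
    have /(kernel_rank_one hD n_gt0 hCm hCn)[t tE] :
        forall w, \sum_(j < _) incidence D w (e j.+1) * u 0 j = 0.
      by move=> w; rewrite -uE.
    by exists t => x; rewrite -[x]eK; have := tE (g x); rewrite mxE cE.
  rewrite uE; apply/(kernel_rank_one hD n_gt0 hCm hCn): w.
  by exists t => j; rewrite mxE tE cE.
have c_neq0 : exists x, c x != 0.
  have /rV0Pn[j cj] := numer_neq0 hD n_gt0 hCm hCn.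
  exists (e j.+1); rewrite cE; apply: contra cj => /eqP bj.
  (* The division is exact, so a zero quotient forces a zero numerator. *)
  rewrite -(divzK (dgcd_dvd v e j)) mulf_eq0.
  by move: bj; rewrite mxE => ->.
split.
- exact: dgcd_dvd.
- exact: rank_one_primitive.
- exact: rank_one_generates.
Qed.
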